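(* Let $A\in M_n(\mathbb{C})$. Then $$B(A)\subseteq\operatorname{conv}\{W_{\mathbb{C}}(A),\,W_{\mathbb{C}}(A^* )\}.$$
   Context: $\mathbb{H}$ denotes the Hamilton quaternions with real basis $1,i,j,k$, and $\mathbb{C}=\mathrm{span}_{\mathbb{R}}\{1,i\}\subset\mathbb{H}$. For $\mathbb{F}=\mathbb{C}$ or $\mathbb{H}$ and $A\in M_n(\mathbb{F})$, the numerical range is $W_{\mathbb{F}}(A)=\{\boldsymbol{x}^*A\boldsymbol{x}:\boldsymbol{x}\in\mathbb{F}^n,\ \boldsymbol{x}^*\boldsymbol{x}=1\}$, where $\boldsymbol{x}$ is a column vector and $^*$ denotes conjugate transpose. A complex matrix is regarded as a quaternionic matrix. The bild of $A$ is $B(A)=W_{\mathbb{H}}(A)\cap\mathbb{C}$. $\operatorname{conv}\{X,Y\}$ is the convex hull of $X\cup Y$. *)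

(* Defs.v *)
From HB Require Import structures.
From mathcomp Require Import all_boot all_order all_algebra.
From mathcomp Require Import ring.
From mathcomp Require Import complex.
From mathcomp Require Import boolp classical_sets reals convex.

Set Implicit Arguments.
Unset Strict Implicit.
Unset Printing Implicit Defensive.

Import GRing.Theory.
Local Open Scope ring_scope.
Local Open Scope classical_set_scope.
Local Open Scope complex_scope.

(* [Quat a b c d] is the Hamilton quaternion a + b i + c j + d k. *)
Record quat (R : Type) : Type := Quat { qre : R; qi : R; qj : R; qk : R }.

Section QuatChoice.
Variable R : Type.

Definition tuple_of_quat (x : quat R) := let: Quat a b c d := x in (a, b, c, d).
Definition quat_of_tuple (t : R * R * R * R) :=
  let: (a, b, c, d) := t in Quat a b c d.

Lemma tuple_of_quatK : cancel tuple_of_quat quat_of_tuple.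
Proof. by case. Qed.

End QuatChoice.

HB.instance Definition _ (R : eqType) :=
  Equality.copy (quat R) (can_type (@tuple_of_quatK R)).
HB.instance Definition _ (R : choiceType) :=
  Choice.copy (quat R) (can_type (@tuple_of_quatK R)).

Section QuatRing.
Variable R : comNzRingType.
Implicit Types x y z : quat R.

Definition addq x y :=
  let: Quat a b c d := x in let: Quat a' b' c' d' := y in
  Quat (a + a') (b + b') (c + c') (d + d').

Definition oppq x := let: Quat a b c d := x in Quat (- a) (- b) (- c) (- d).

(* i^2 = j^2 = k^2 = -1, ij = k = -ji, jk = i = -kj, ki = j = -ik *)
Definition mulq x y :=
  let: Quat a b c d := x in let: Quat a' b' c' d' := y in
  Quat (a * a' - b * b' - c * c' - d * d')
       (a * b' + b * a' + c * d' - d * c')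
       (a * c' - b * d' + c * a' + d * b')
       (a * d' + b * c' - c * b' + d * a').

Let addqA : associative addq.
Proof. by case=> ? ? ? ? [? ? ? ?] [? ? ? ?]; rewrite /addq !addrA. Qed.

Let addqC : commutative addq.
Proof. by case=> ? ? ? ? [? ? ? ?]; congr Quat; rewrite addrC. Qed.

Let add0q : left_id (Quat 0 0 0 0) addq.
Proof. by case=> ? ? ? ?; rewrite /addq !add0r. Qed.

Let addNq : left_inverse (Quat 0 0 0 0) oppq addq.
Proof. by case=> ? ? ? ?; rewrite /addq /oppq !addNr. Qed.

HB.instance Definition _ :=
  GRing.isZmodule.Build (quat R) addqA addqC add0q addNq.

Let mulqA : associative mulq.
Proof. by case=> ? ? ? ? [? ? ? ?] [? ? ? ?]; congr Quat; ring. Qed.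

Let mul1q : left_id (Quat 1 0 0 0) mulq.
Proof. by case=> ? ? ? ?; congr Quat; ring. Qed.

Let mulq1 : right_id (Quat 1 0 0 0) mulq.
Proof. by case=> ? ? ? ?; congr Quat; ring. Qed.

Let mulqDl : left_distributive mulq addq.
Proof. by case=> ? ? ? ? [? ? ? ?] [? ? ? ?]; congr Quat; ring. Qed.

Let mulqDr : right_distributive mulq addq.
Proof. by case=> ? ? ? ? [? ? ? ?] [? ? ? ?]; congr Quat; ring. Qed.

Let oneq_neq0 : Quat 1 0 0 0 != 0 :> quat R.
Proof. by apply/eqP => -[/eqP]; rewrite oner_eq0. Qed.

HB.instance Definition _ := GRing.Zmodule_isNzRing.Build (quat R)
  mulqA mul1q mulq1 mulqDl mulqDr oneq_neq0.

Definition conjq x := let: Quat a b c d := x in Quat a (- b) (- c) (- d).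

Definition quat_of_complex (z : R[i]) : quat R :=
  let: a +i* b := z in Quat a b 0 0.

End QuatRing.

Definition adjmx (F : Type) (conj : F -> F) m n (A : 'M[F]_(m, n)) :
  'M[F]_(n, m) := (map_mx conj A)^T.

Definition numrange (F : nzRingType) (conj : F -> F) n (A : 'M[F]_n) : set F :=
  [set (adjmx conj x *m A *m x) 0 0 |
    x in [set x : 'cV[F]_n | (adjmx conj x *m x) 0 0 = 1]].

Definition numrangeC (R : realType) n (A : 'M[R[i]]_n) : set R[i] :=
  numrange (@conjc R) A.

Definition numrangeH (R : realType) n (A : 'M[quat R]_n) : set (quat R) :=
  numrange (@conjq R) A.

(* The intersection with C, viewed as a subset of C itself. *)
Definition bild (R : realType) n (A : 'M[quat R]_n) : set R[i] :=
  @quat_of_complex R @^-1` numrangeH A.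

(* Convexity in C is with respect to its real vector space structure, which is
   carried by [Rcomplex R]. *)
Definition conv2 (R : realType) (X Y : set R[i]) : set R[i] :=
  smallest (@convex_set R (Rcomplex R)) (X `|` Y).

(* Main.v *)
(** Write [x = u + v j] with [u, v] complex vectors.  Since [- j z j] is the
    conjugate of [z] for complex [z], the complex part of [x^* A x] is
    [u^* A u + v^* A^* v], and [u^* u + v^* v = 1]; after normalising [u] and
    [v] this is a convex combination of points of the two numerical ranges. *)

Require Import Defs.
From mathcomp Require Import all_boot all_order all_algebra.
From mathcomp Require Import ring.
From mathcomp Require Import complex.
From mathcomp Require Import boolp classical_sets reals convex.
From mathcomp Require Import interval_inference.

Set Implicit Arguments.
Unset Strict Implicit.
Unset Printing Implicit Defensive.

Import Order.TTheory GRing.Theory Num.Theory.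
Local Open Scope ring_scope.
Local Open Scope classical_set_scope.
Local Open Scope complex_scope.

Definition quad_form (F : pzSemiRingType) (conj : F -> F) n
  (A : 'M[F]_n) (x : 'cV[F]_n) : F := (adjmx conj x *m A *m x) 0 0.

Definition complex_part (R : Type) (x : quat R) : R[i] := qre x +i* qi x.
(** The unit [j] stands on the right, [x = complex_part x + j_part x * j], because [i j = k]; on the
    left the sign of [qk] would flip. *)
Definition j_part (R : Type) (x : quat R) : R[i] := qj x +i* qk x.

Lemma quad_formE (F : pzSemiRingType) (conj : F -> F) n
    (A : 'M[F]_n) (x : 'cV[F]_n) :
  quad_form conj A x = \sum_i \sum_j conj (x i 0) * A i j * x j 0.
Proof.
rewrite exchange_big /quad_form mxE; apply: eq_bigr => j _.
by rewrite mxE mulr_suml; apply: eq_bigr => i _; rewrite !mxE.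
Qed.

Lemma complex_part0 (R : rcfType) : complex_part (0 : quat R) = 0.
Proof. by []. Qed.

Lemma complex_partD (R : rcfType) :
  {morph @complex_part R : x y / x + y}.
Proof. by move=> [? ? ? ?] [? ? ? ?]. Qed.

(** For [x = u + v j] and [y = u' + v' j], the second term is [- j (conj v * z * v') j], the
    conjugate of [conj v * z * v']. Conjugation is what exchanges the places of [x] and [y]. *)
Lemma complex_part_conj_mul (R : rcfType) (x y : quat R) (z : R[i]) :
  complex_part (conjq x * quat_of_complex z * y) =
  conjc (complex_part x) * z * complex_part y +
  conjc (j_part y) * conjc z * j_part x.
Proof.
case: x y z => [a b c d] [a' b' c' d'] [e f].
by rewrite /complex_part /j_part; congr Complex => /=; ring.
Qed.

Lemma complex_part_quad_form (R : rcfType) n (A : 'M[R[i]]_n)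
    (x : 'cV[quat R]_n) :
  complex_part (quad_form (@conjq R) (map_mx (@quat_of_complex R) A) x) =
  quad_form (@conjc R) A (map_mx (@complex_part R) x) +
  quad_form (@conjc R) (adjmx (@conjc R) A) (map_mx (@j_part R) x).
Proof.
have cpD := @complex_partD R; have cp0 := complex_part0 R.
(* Since [x] and [y] change places in the second term, its sum is transposed; its terms then carry
   the conjugate of [A i j], an entry of the adjoint. *)
rewrite !quad_formE (big_morph _ cpD cp0) [in X in _ + X]exchange_big.
rewrite -big_split; apply: eq_bigr => i _.
rewrite (big_morph _ cpD cp0) -big_split; apply: eq_bigr => j _.
by rewrite !mxE complex_part_conj_mul.
Qed.

(** This is the previous lemma at the identity matrix, which is its own adjoint. *)
Lemma complex_part_norm (R : rcfType) n (x : 'cV[quat R]_n) :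
  complex_part ((adjmx (@conjq R) x *m x) 0 0) =
  (adjmx (@conjc R) (map_mx (@complex_part R) x) *m
     map_mx (@complex_part R) x) 0 0 +
  (adjmx (@conjc R) (map_mx (@j_part R) x) *m map_mx (@j_part R) x) 0 0.
Proof.
have := complex_part_quad_form 1%:M x; rewrite /quad_form.
have -> : map_mx (@quat_of_complex R) 1%:M = 1%:M :> 'M_n.
  by apply/matrixP => i j; rewrite !mxE; case: (i == j).
have -> : adjmx (@conjc R) 1%:M = 1%:M :> 'M_n.
  apply/matrixP => i j; rewrite !mxE eq_sym.
  by case: (i == j); rewrite ?conjc0 ?conjc1.
by rewrite !mulmx1.
Qed.

(** The witness is the sum of squares of the real coordinates. As a real number it can serve as a
    convex weight, and weight zero is the case where [u] cannot be normalised. *)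
Lemma sqnorm_real (R : rcfType) n (u : 'cV[R[i]]_n) :
  exists t : R, [/\ 0 <= t, (adjmx (@conjc R) u *m u) 0 0 = t%:C
    & t = 0 -> u = 0].
Proof.
exists (\sum_i (complex.Re (u i 0) ^+ 2 + complex.Im (u i 0) ^+ 2)).
have ge0 i : 0 <= complex.Re (u i 0) ^+ 2 + complex.Im (u i 0) ^+ 2.
  by rewrite addr_ge0 ?sqr_ge0.
split; first exact: sumr_ge0.
- rewrite mxE rmorph_sum; apply: eq_bigr => i _; rewrite !mxE.
  by case: (u i 0) => a b; congr Complex => /=; ring.
- move=> /eqP; rewrite psumr_eq0 // => /allP u0.
  apply/colP => i; rewrite mxE; have := u0 i (mem_index_enum i).
  rewrite paddr_eq0 ?sqr_ge0 // !sqrf_eq0.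
  by case: (u i 0) => a b /= /andP[/eqP -> /eqP ->].
Qed.

Lemma quad_formZ (R : rcfType) n (A : 'M[R[i]]_n) (u : 'cV[R[i]]_n)
    (c : R) :
  quad_form (@conjc R) A (c%:C *: u) =
  (c ^+ 2)%:C * quad_form (@conjc R) A u.
Proof.
have cc (w : R[i]) : conjc (c%:C * w) = c%:C * conjc w.
  by case: w => a b; congr Complex => /=; ring.
rewrite !quad_formE mulr_sumr; apply: eq_bigr => i _.
rewrite mulr_sumr; apply: eq_bigr => j _; rewrite !mxE cc rmorphXn /=; ring.
Qed.

Lemma numrangeC_normalize (R : realType) n (A : 'M[R[i]]_n)
    (u : 'cV[R[i]]_n) (t : R) :
  0 < t -> (adjmx (@conjc R) u *m u) 0 0 = t%:C ->
  numrangeC A ((t^-1)%:C * quad_form (@conjc R) A u).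
Proof.
move=> t0 ut; have sq : ((Num.sqrt t)^-1) ^+ 2 = t^-1.
  by rewrite exprVn sqr_sqrtr // ltW.
exists (((Num.sqrt t)^-1)%:C *: u); last by rewrite -sq -quad_formZ.
(* At the identity matrix the scaling rule shows that [u] divided by the root of [t] is a unit
   vector. *)
have := quad_formZ 1%:M u (Num.sqrt t)^-1.
by rewrite /quad_form !mulmx1 ut sq -rmorphM /= mulVf ?gt_eqF // => ->.
Qed.

Lemma quad_form0 (F : pzRingType) (conj : F -> F) n (A : 'M[F]_n) :
  quad_form conj A 0 = 0.
Proof. by rewrite /quad_form mulmx0 mxE. Qed.

Theorem corollary3p2 (R : realType) (n : nat) (A : 'M[R[i]]_n) :
  bild (map_mx (@quat_of_complex R) A) `<=`
  conv2 (numrangeC A) (numrangeC (adjmx (@conjc R) A)).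
Proof.
(* The hull is a smallest set, so [z] must be shown to lie in an arbitrary convex [M] containing
   both ranges. *)
move=> z [x x1 xz] M [cM]; rewrite subUset => -[WM WsM].
have {xz} := congr1 (@complex_part R) xz.
have {x1} := congr1 (@complex_part R) x1.
rewrite complex_part_norm -/(quad_form _ _ _) complex_part_quad_form.
have -> : complex_part (quat_of_complex z) = z by case: z.
have -> : complex_part (1 : quat R) = 1%:C by [].
set u := map_mx _ x; set v := map_mx _ x.
have [s [s0 us u0]] := sqnorm_real u.
have [t [t0 vt v0]] := sqnorm_real v.
rewrite us vt -rmorphD => -[st1] <-.
have inW r w (B : 'M_n) : r = 1 -> (adjmx (@conjc R) w *m w) 0 0 = r%:C ->
    numrangeC B (quad_form (@conjc R) B w).
  by move=> -> w1; exists w.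
(* If one weight vanishes, so does its vector; the other is already a unit vector and [z] lies in a
   single range. *)
have [s00|sn0] := eqVneq s 0.
  rewrite u0 // quad_form0 add0r; apply/WsM/(inW t) => //.
  by rewrite -st1 s00 add0r.
have [t00|tn0] := eqVneq t 0.
  rewrite v0 // quad_form0 addr0; apply/WM/(inW s) => //.
  by rewrite -st1 t00 addr0.
have sp : 0 < s by rewrite lt_def sn0.
have tp : 0 < t by rewrite lt_def tn0.
have s1 : s <= 1 by rewrite -st1 lerDl.
(* The normalised points carry factors [s^-1] and [t^-1], which the weights [s] and [1 - s = t]
   cancel. *)
have := cM _ _ (Itv01 s0 s1)
  (mem_set (WM _ (numrangeC_normalize A sp us)))
  (mem_set (WsM _ (numrangeC_normalize (adjmx (@conjc R) A) tp vt))).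
move/set_mem; congr M.
(* Real scaling in [Rcomplex R] has to cancel a complex product with an embedded real; this is
   checked on coordinates. *)
have sc (c : R) (w : R[i]) : c != 0 ->
    c *: ((c^-1)%:C * w : Rcomplex R) = w.
  by case: w => a b c0; congr Complex => /=; field.
rewrite /conv /= (_ : unstable.onem s = t); last first.
  by rewrite /unstable.onem -st1 addrC addKr.
by congr (_ + _); apply: sc.
Qed.
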